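(* Let $\zeta\in\mathbb{C}$ be a primitive third root of unity, let $e_0,e_1,e_2,e_3$ be the standard basis of $\mathbb{C}^4$, and let $$S=\{\,[e_i-\zeta^a e_j]\;\mid\; i\in\{0,1\},\ j\in\{2,3\},\ a\in\mathbb{Z}/3\mathbb{Z}\,\}\subset\mathbb{P}^3_{\mathbb{C}}.$$ Then $S$ spans $\mathbb{P}^3_{\mathbb{C}}$, and $S$ is not contained in the union of two skew lines.
   Context: $[v]$ denotes the point of $\mathbb{P}^3_{\mathbb{C}}=\mathbb{P}(\mathbb{C}^4)$ represented by a nonzero vector $v\in\mathbb{C}^4$. Two lines in $\mathbb{P}^3_{\mathbb{C}}$ are skew if they are disjoint. *)

(* Defs.v *)
From HB Require Import structures.
From mathcomp Require Import all_boot all_order all_algebra.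
From mathcomp Require Import classical_sets.

Set Implicit Arguments.
Unset Strict Implicit.
Unset Printing Implicit Defensive.

Import GRing.Theory.

Local Open Scope ring_scope.
Local Open Scope classical_set_scope.

Section ProjectiveSpace.
Variables (K : fieldType) (V : vectType K).

(* P(V): points are the one-dimensional subspaces of V. *)
Record projective : Type :=
  Projective { pline :> {vspace V}; _ : \dim pline == 1%N }.

HB.instance Definition _ := [isSub for pline].

Fact dim_pclass (v : V) : v != 0 -> \dim <[v]>%VS == 1%N.
Proof. by move=> v0; rewrite dim_vline v0. Qed.

(* The point [v] represented by a nonzero vector v. *)
Definition pclass (v : V) (v_neq0 : v != 0) : projective :=
  Projective (dim_pclass v_neq0).

(* P(W) seen as a subset of P(V). *)
Definition psub (W : {vspace V}) : set projective :=
  [set p : projective | (pline p <= W)%VS].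

Definition pspan (S : set projective) : set projective :=
  \bigcap_(W in [set W : {vspace V} | S `<=` psub W]) psub W.

Definition is_pline (L : set projective) : Prop :=
  exists2 W : {vspace V}, \dim W = 2%N & L = psub W.

Definition skew_lines (L M : set projective) : Prop :=
  [/\ is_pline L, is_pline M & L `&` M = set0].

End ProjectiveSpace.

Section TwelvePoints.
Variable K : fieldType.

Definition evec (i : 'I_4) : 'rV[K]_4 := delta_mx 0 i.

(* The nonvanishing required in the definition of S_zeta is never a restriction. *)
Fact evecB_neq0 (i j : 'I_4) (c : K) :
  (i < 2)%N -> (2 <= j)%N -> evec i - c *: evec j != 0.
Proof.
move=> i2 j2; apply/eqP => /matrixP /(_ 0 i); rewrite !mxE !eqxx /=.
have -> : (i == j) = false by apply/eqP => ij; move: i2; rewrite ij ltnNge j2.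
by rewrite mulr0 subr0 => /eqP; rewrite oner_eq0.
Qed.

Definition S_zeta (zeta : K) : set (projective 'rV[K]_4) :=
  [set p | exists (i j : 'I_4) (a : 'Z_3)
             (nz : evec i - zeta ^+ a *: evec j != 0),
      [/\ (i < 2)%N, (2 <= j)%N & p = pclass nz]].

End TwelvePoints.

(* Main.v *)
Require Import Defs.
From mathcomp Require Import all_boot all_order all_algebra.
From mathcomp Require Import complex.
From mathcomp Require Import classical_sets reals.

Import GRing.Theory.

Local Open Scope ring_scope.
Local Open Scope classical_set_scope.
Local Open Scope complex_scope.

(** For each of the four pairs (i, j), the three points [e_i - zeta^a e_j] lie
    on the line spanned by [e_i] and [e_j], and any two of them span it. Hence
    S spans all the [e_k]. If S lay in a union of two lines, the pigeonhole
    principle would put [e_i] and [e_j] on a common one of them, for each pair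
    (i, j); whichever line is chosen for the pairs (0,2), (1,3) and (0,3), one
    of the two lines would then contain three of the [e_k]. *)

Lemma psub_pclass (K : fieldType) (V : vectType K) (W : {vspace V}) (v : V)
    (v_neq0 : v != 0) :
  psub W (pclass v_neq0) <-> v \in W.
Proof. by rewrite /psub /= memvE. Qed.

(** The difference of the two given vectors is [(b - a) *: v], and [b - a] is invertible; once [v]
    is in [W], so is [u]. *)
Lemma memv_pencil (K : fieldType) (V : vectType K) (W : {vspace V}) (u v : V)
    (a b : K) :
  a != b -> u - a *: v \in W -> u - b *: v \in W -> u \in W /\ v \in W.
Proof.
move=> ab ua ub; have vW : v \in W.
  have /(memvZ (b - a)^-1) : (b - a) *: v \in W.
    have -> : (b - a) *: v = (u - a *: v) - (u - b *: v).
      by rewrite opprB [RHS]addrC addrA subrK scalerBl.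
    exact: memvB.
  by rewrite scalerK // subr_eq0 eq_sym.
by split=> //; rewrite -[u](subrK (a *: v)) memvD ?memvZ.
Qed.

Lemma evec_memv_full (K : fieldType) (W : {vspace 'rV[K]_4}) :
  (forall k, evec K k \in W) -> W = fullv.
Proof.
move=> We; apply/vspaceP => w; rewrite memvf (row_sum_delta w).
by apply: memv_suml => k _; exact/memvZ/We.
Qed.

(** Adjoining the single vector [evec K l] to [W] gives the whole 4-dimensional space, and this
    raises the dimension by at most one. *)
Lemma evec_memv_dim_ge3 (K : fieldType) (W : {vspace 'rV[K]_4}) (l : 'I_4) :
  (forall k, k != l -> evec K k \in W) -> (3 <= \dim W)%N.
Proof.
move=> We; have full : (W + <[evec K l]>)%VS = fullv.
  apply: evec_memv_full => k; have [->|kl] := eqVneq k l.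
    exact/(subvP (addvSr _ _))/memv_line.
  exact/(subvP (addvSl _ _))/We.
have := dimv_add_leqif W <[evec K l]>%VS; rewrite full dimvf /dim /= => -[le4 _].
have : (4 <= \dim W + 1)%N.
  by apply: leq_trans le4 _; rewrite leq_add2l dim_vline leq_b1.
by rewrite addn1.
Qed.

Section TwelvePoints.
Variables (K : fieldType) (zeta : K) (zeta_prim : 3.-primitive_root zeta).

Lemma S_zeta_pclass (i j : 'I_4) (a : 'Z_3) (i2 : (i < 2)%N) (j2 : (2 <= j)%N) :
  S_zeta zeta (pclass (evecB_neq0 (zeta ^+ a) i2 j2)).
Proof. by exists i, j, a, (evecB_neq0 (zeta ^+ a) i2 j2). Qed.

Lemma zeta_exp_neq (a b : 'Z_3) : a != b -> zeta ^+ a != zeta ^+ b.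
Proof.
by rewrite (eq_prim_root_expr zeta_prim) !modn_small // ?(ltn_ord a) ?(ltn_ord b).
Qed.

Lemma S_zeta_sub_psubU (W1 W2 : {vspace 'rV[K]_4}) (i j : 'I_4) :
  S_zeta zeta `<=` psub W1 `|` psub W2 -> (i < 2)%N -> (2 <= j)%N ->
  (evec K i \in W1 /\ evec K j \in W1) \/ (evec K i \in W2 /\ evec K j \in W2).
Proof.
move=> SW i2 j2.
have mem (a : 'Z_3) : evec K i - zeta ^+ a *: evec K j \in W1 \/
    evec K i - zeta ^+ a *: evec K j \in W2.
  by case: (SW _ (S_zeta_pclass i j a i2 j2)) => /psub_pclass; [left|right].
have two (W : {vspace 'rV[K]_4}) (a b : 'Z_3) : a != b ->
    evec K i - zeta ^+ a *: evec K j \in W ->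
    evec K i - zeta ^+ b *: evec K j \in W -> evec K i \in W /\ evec K j \in W.
  by move=> /zeta_exp_neq; exact: memv_pencil.
have [n01 n02 n12] : [/\ 0 != 1 :> 'Z_3, 0 != 2 :> 'Z_3 & 1 != 2 :> 'Z_3] by [].
(* Eight distributions of the exponents 0, 1, 2 over [W1] and [W2]; each puts two distinct exponents
   in the same subspace. *)
case: (mem 0) (mem 1) (mem 2) => m0 [] m1 [] m2.
- by left; exact: two _ _ _ n01 m0 m1.
- by left; exact: two _ _ _ n01 m0 m1.
- by left; exact: two _ _ _ n02 m0 m2.
- by right; exact: two _ _ _ n12 m1 m2.
- by left; exact: two _ _ _ n12 m1 m2.
- by right; exact: two _ _ _ n02 m0 m2.
- by right; exact: two _ _ _ n01 m0 m1.
- by right; exact: two _ _ _ n01 m0 m1.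
Qed.

(** This is the degenerate case [W1 = W2 = W] of the pigeonhole lemma: every basis vector occurs in
    some pair (i, j), so all four lie in [W]. *)
Lemma S_zeta_sub_psub (W : {vspace 'rV[K]_4}) :
  S_zeta zeta `<=` psub W -> W = fullv.
Proof.
move=> SW; have SWW : S_zeta zeta `<=` psub W `|` psub W by rewrite setUid.
have pair (i j : 'I_4) : (i < 2)%N -> (2 <= j)%N -> evec K i \in W /\ evec K j \in W.
  by move=> i2 j2; case: (S_zeta_sub_psubU _ _ _ _ SWW i2 j2).
apply: evec_memv_full => k; case: (ltnP k 2) => k2.
  by have [] := pair k ord_max k2 isT.
by have [] := pair 0 k isT k2.
Qed.

Lemma pspan_S_zeta : pspan (S_zeta zeta) = setT.
Proof.
(* The intersection defining the span runs over [fullv] alone. *)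
apply/seteqP; split=> // p _ W /= /S_zeta_sub_psub ->; exact: subvf.
Qed.

Lemma S_zeta_not_sub_two_plines (L M : set (projective 'rV[K]_4)) :
  is_pline L -> is_pline M -> ~ S_zeta zeta `<=` L `|` M.
Proof.
move=> [W1 dW1 ->] [W2 dW2 ->] SW.
pose e k : 'I_4 := inord k.
have no3 (W : {vspace 'rV[K]_4}) (l : 'I_4) :
    \dim W = 2%N -> ~ (forall k, k != l -> evec K k \in W).
  by move=> dW /evec_memv_dim_ge3; rewrite dW.
(* The two lines play symmetric roles, so [W1] may be taken to be the one that receives the pair (0,
   2). *)
wlog [e0 e2] : W1 W2 dW1 dW2 SW / evec K (e 0%N) \in W1 /\ evec K (e 2%N) \in W1.
  move=> wl; have [] := S_zeta_sub_psubU W1 W2 (e 0%N) (e 2%N) SW;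
    rewrite ?inordK //; first exact: (wl W1 W2).
  by apply: (wl W2 W1) => //; rewrite setUC.
have ordE (P : 'I_4 -> Prop) :
    P (e 0%N) -> P (e 1%N) -> P (e 2%N) -> P (e 3%N) -> forall k, P k.
  move=> P0 P1 P2 P3 k; rewrite -(inord_val k).
  by case: k => [[|[|[|[|]]]]].
(* If (1, 3) also falls in [W1], then [W1] contains all four basis vectors; otherwise [W2] receives
   (1, 3). *)
have [||[e1 e3]|[e1 e3]] := S_zeta_sub_psubU W1 W2 (e 1%N) (e 3%N) SW;
  rewrite ?inordK //.
  by apply: (no3 W1 (e 0%N) dW1); apply: ordE.
(* The pair (0, 3) shares one index with each earlier pair: it completes [W1] to indices 0, 2, 3 or
   [W2] to 0, 1, 3. *)
have [||[e0' e3']|[e0' e3']] := S_zeta_sub_psubU W1 W2 (e 0%N) (e 3%N) SW;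
  rewrite ?inordK //.
  by apply: (no3 W1 (e 1%N) dW1); apply: ordE => //; rewrite eqxx.
by apply: (no3 W2 (e 2%N) dW2); apply: ordE => //; rewrite eqxx.
Qed.

End TwelvePoints.

Theorem lemma5p1 (R : realType) (zeta : R[i])
    (zeta_prim : 3.-primitive_root zeta) :
  pspan (S_zeta zeta) = setT /\
  ~ (exists L M : set (projective 'rV[R[i]]_4),
       skew_lines L M /\ S_zeta zeta `<=` L `|` M).
Proof.
split; first exact: pspan_S_zeta.
move=> [L [M [[lineL lineM _]]]]; exact: S_zeta_not_sub_two_plines.
Qed.
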